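(* Let $\alpha>-1$, $\beta\in\mathbb{R}$, $k^2\in(0,1)$, and let $P_n(x)$ be the monic orthogonal polynomials with respect to $w(x,k^2)=(1-x^2)^{\alpha}(1-k^2x^2)^{\beta}$ on $[-1,1]$, with recurrence coefficients $\beta_n$ and sub-leading coefficients $\mathsf{p}_1(n)$. Then for every $n\ge0$ (at all $x$ where the denominators do not vanish) $$P_n''(x)+\left(\frac12\frac{X'(x)}{X(x)}-\frac{M_n'(x)}{M_n(x)}\right)P_n'(x)+\left(\frac{L_n(x)M_n'(x)}{Y(x)M_n(x)}+\frac{U_n(x)}{Y(x)}\right)P_n(x)=0,$$ where $$\begin{aligned} X(x)&:=(1-x^2)^{2\alpha+2}(1-k^2x^2)^{2\beta+2},\\ Y(x)&:=(1-x^2)(1-k^2x^2),\\ M_n(x)&:=-2\big(\alpha+\beta+n+\tfrac12\big)k^2x^2-C_n,\\ L_n(x)&:=x\Big[nk^2x^2-n(1+k^2)+2k^2\big(\alpha+\beta+n+\tfrac12\big)\beta_n-2k^2\mathsf{p}_1(n)\Big],\\ U_n(x)&:=-k^2x^2n(n+2\alpha+2\beta+3)+2k^2(2n+2\alpha+2\beta+1)(\mathsf{p}_1(n)-\beta_n)+nk^2(n+2\beta+1)+n(n+2\alpha+1), \end{aligned}$$ and $$C_n:=2\big(\alpha+\beta+n+\tfrac32\big)k^2(\beta_n+\beta_{n+1})-2\Big[\big(\beta+n+\tfrac12\big)k^2+\big(\alpha+n+\tfrac12\big)\Big]-4k^2\mathsf{p}_1(n).$$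
   Context: For $\alpha>-1$, $\beta\in\mathbb{R}$, $k^2\in(0,1)$, the weight is $w(x,k^2)=(1-x^2)^{\alpha}(1-k^2x^2)^{\beta}$, $x\in[-1,1]$. For $n\ge0$, $P_n$ is the monic polynomial of degree $n$ with $\int_{-1}^1 P_i(x)P_j(x)w(x,k^2)\,dx=h_j\delta_{i,j}$. As $w$ is even, $P_n(x)=x^n+\mathsf{p}_1(n)x^{n-2}+\dots+P_n(0)$, with $\mathsf{p}_1(0)=\mathsf{p}_1(1):=0$. The recurrence coefficients $\beta_n$ (with an index; $\beta$ without index is the exponent) are defined by $xP_n(x)=P_{n+1}(x)+\beta_nP_{n-1}(x)$, with $P_{-1}:=0$, $\beta_0:=0$; thus $\beta_n=h_n/h_{n-1}$ for $n\ge1$. Primes denote $d/dx$. *)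

(* Defs.v *)
From HB Require Import structures.
From mathcomp Require Import all_boot all_order all_algebra.
From mathcomp Require Import all_classical all_reals all_analysis.
From mathcomp Require Import lra.

Set Implicit Arguments.
Unset Strict Implicit.
Unset Printing Implicit Defensive.

Import Order.TTheory GRing.Theory Num.Theory.
Import numFieldNormedType.Exports.

Local Open Scope classical_set_scope.
Local Open Scope ring_scope.

(* For alpha < 0 Mathcomp's convention 0 `^ alpha = 0 replaces the infinite
   value at the two endpoints x = -1, 1, a Lebesgue-null set. *)
Definition weight (R : realType) (alpha beta k x : R) : R :=
  ((1 - x ^+ 2) `^ alpha) * ((1 - k ^+ 2 * x ^+ 2) `^ beta).

Definition monic_orthogonal (R : realType) (w : R -> R)
    (P : nat -> {poly R}) (h : nat -> R) : Prop :=
  (forall n, P n \is monic /\ size (P n) = n.+1) /\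
  (forall i j, \int[lebesgue_measure]_(x in `[(-1 : R), 1])
                  ((P i).[x] * (P j).[x] * w x) = h j * (i == j)%:R).

(* P_{n-1}, with P_{-1} := 0 *)
Definition prev_poly (R : realType) (P : nat -> {poly R}) (n : nat) : {poly R} :=
  if n is m.+1 then P m else 0.

Definition recurrence_coeffs (R : realType) (P : nat -> {poly R})
    (b : nat -> R) : Prop :=
  b 0%N = 0 /\
  forall n, 'X * P n = P n.+1 + b n *: prev_poly P n.

(* The coefficient of 'X^(n-2) in P_n *)
Definition subleading (R : realType) (P : nat -> {poly R}) (n : nat) : R :=
  if (n < 2)%N then 0 else (P n)`_(n - 2).

Section Coefficients.
Variables (R : realType) (alpha beta k : R).

(* Real powers need nonnegative bases, whereas X'/X makes sense wherever neither
   base vanishes.  The absolute values give the common modulus of all branches of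
   (1 - x^2)^(2 alpha + 2) (1 - k^2 x^2)^(2 beta + 2); branches differ by locally
   constant factors, so X'/X does not depend on the choice.  On ]-1, 1[ the
   absolute values are redundant, see odeXE. *)
Definition odeX (x : R) : R :=
  (`|1 - x ^+ 2| `^ (2 * alpha + 2)) *
  (`|1 - k ^+ 2 * x ^+ 2| `^ (2 * beta + 2)).

Lemma odeXE (x : R) : k ^+ 2 < 1 -> -1 < x < 1 ->
  odeX x = ((1 - x ^+ 2) `^ (2 * alpha + 2)) *
            ((1 - k ^+ 2 * x ^+ 2) `^ (2 * beta + 2)).
Proof.
move=> k1 /andP[x0 x1]; have k0 : 0 <= k ^+ 2 by exact: sqr_ge0.
have xx0 : 0 <= x ^+ 2 by exact: sqr_ge0.
have xx1 : x ^+ 2 <= 1 by nra.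
have kx1 : k ^+ 2 * x ^+ 2 <= 1 by exact: (mulr_ile1 k0 xx0 (ltW k1) xx1).
by rewrite /odeX !ger0_norm// subr_ge0.
Qed.

Definition odeY (x : R) : R := (1 - x ^+ 2) * (1 - k ^+ 2 * x ^+ 2).

Variables (P : nat -> {poly R}) (b : nat -> R).

Definition odeC (n : nat) : R :=
  2 * (alpha + beta + n%:R + 3 / 2) * k ^+ 2 * (b n + b n.+1)
  - 2 * ((beta + n%:R + 1 / 2) * k ^+ 2 + (alpha + n%:R + 1 / 2))
  - 4 * k ^+ 2 * subleading P n.

Definition odeM (n : nat) (x : R) : R :=
  - 2 * (alpha + beta + n%:R + 1 / 2) * k ^+ 2 * x ^+ 2 - odeC n.

Definition odeL (n : nat) (x : R) : R :=
  x * (n%:R * k ^+ 2 * x ^+ 2 - n%:R * (1 + k ^+ 2)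
       + 2 * k ^+ 2 * (alpha + beta + n%:R + 1 / 2) * b n
       - 2 * k ^+ 2 * subleading P n).

Definition odeU (n : nat) (x : R) : R :=
  - k ^+ 2 * x ^+ 2 * n%:R * (n%:R + 2 * alpha + 2 * beta + 3)
  + 2 * k ^+ 2 * (2 * n%:R + 2 * alpha + 2 * beta + 1) * (subleading P n - b n)
  + n%:R * k ^+ 2 * (n%:R + 2 * beta + 1)
  + n%:R * (n%:R + 2 * alpha + 1).

End Coefficients.

(* Main.v *)
Require Import Defs.
From HB Require Import structures.
From mathcomp Require Import all_boot all_order all_algebra.
From mathcomp Require Import all_classical all_reals all_analysis.
From mathcomp Require Import measurable_realfun.
From mathcomp Require Import ring lra zify.

Set Implicit Arguments.
Unset Strict Implicit.
Unset Printing Implicit Defensive.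

Import Order.TTheory GRing.Theory Num.Theory.
Import numFieldNormedType.Exports.

Local Open Scope classical_set_scope.
Local Open Scope ring_scope.

(** Write K for k^2 and let L(p) be the integral of p w over [-1, 1], where w is
    the weight.  With Y = (1 - x^2)(1 - K x^2) the product Y w satisfies a Pearson
    equation (Y w)' = T w with T an odd cubic polynomial, and Y w vanishes at both
    endpoints because alpha > -1.  Hence L(p' Y + p T) = 0 for every polynomial p
    ([weighted_integral_pearson]).  This identity, the orthogonality relations and
    the three-term recurrence are all that the algebra uses.

    With q_n = b_n P_{n-1}, the differential equation is the combination of two
    polynomial identities
      (1)  Y P_n' = L_n P_n + M_n q_n                ([structure_relation]),
      (2)  Y P_n'' + T P_n' + U_n P_n = M_n' q_n     ([polynomial_ode]):
    eliminating q_n between them gives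
      M_n (Y P_n'' + T P_n' + U_n P_n) = M_n' (Y P_n' - L_n P_n),
    and division by Y M_n gives the equation, since (1/2) X'/X = T/Y
    ([odeX_log_derivative]).

    Both identities are proved by the same scheme.  The difference E of the two
    sides has degree at most n+3 in (1) and n+2 in (2), and a definite parity.  The
    coefficients of L_n and U_n and the leading coefficient of M_n are such that
    those of E cancel in all degrees at least n, so that deg E < n.  It remains to
    see that L(P_j E) = 0 for j < n ([orth_complete]).  By the Pearson identity the
    operator p -> Y p'' + T p' is symmetric for L, and p -> Y p' is antisymmetric up
    to T; so L(P_j E) becomes a combination of L(P_n D) and L(P_{n-1} D') with
    deg D <= j+3 and deg D' <= j+2 in (1), and each of these bounds one less in (2).
    Parity and degree leave only j = n-1 and j = n-3 in (1) and j = n-2 in (2).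
    There the values of L are read off from top coefficients ([orth_top],
    [orth_top2]); the case j = n-1 is where the formula for C_n comes from.

    The analytic part supplies the hypotheses on L: p w is integrable, L has the
    Pearson property, and L(p^2) <> 0 for p <> 0.  For alpha < 0 the weight is
    unbounded at the endpoints, hence the dominating function
    (1 - x)^alpha + (1 + x)^alpha, which has a bounded primitive, and a fundamental
    theorem of calculus for integrable functions that are continuous only in the
    open interval ([integrable_FTC2]). *)

(** * Parity of polynomials *)

Section Parity.
Variable R : comNzRingType.
Implicit Types (p q : {poly R}) (c d : bool).

Definition has_parity c p := forall i, odd i != c -> p`_i = 0.

Lemma has_parity0 c : has_parity c 0.
Proof. by move=> i _; rewrite coef0. Qed.

Lemma has_parityD c p q :
  has_parity c p -> has_parity c q -> has_parity c (p + q).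
Proof. by move=> hp hq i hi; rewrite coefD hp// hq// addr0. Qed.

Lemma has_parityZ c (a : R) p : has_parity c p -> has_parity c (a *: p).
Proof. by move=> hp i hi; rewrite coefZ hp// mulr0. Qed.

Lemma has_parityB c p q :
  has_parity c p -> has_parity c q -> has_parity c (p - q).
Proof. by move=> hp hq i hi; rewrite coefB hp// hq// subr0. Qed.

Lemma has_parityM c d p q :
  has_parity c p -> has_parity d q -> has_parity (c (+) d) (p * q).
Proof.
move=> hp hq i hi; rewrite coefM big1// => -[j /= ji] _.
have [hj|hj] := eqVneq (odd j) c; last by rewrite hp ?mul0r.
rewrite hq ?mulr0//; rewrite oddB// hj.
by apply: contra hi => /eqP <-; rewrite addbCA addbb addbF.
Qed.

Lemma has_parity_deriv c p : has_parity c p -> has_parity (~~ c) p^`().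
Proof.
move=> hp i hi; rewrite coef_deriv hp ?mul0rn//=.
by apply: contra hi => /eqP <-; rewrite negbK.
Qed.

Lemma has_parityC (a : R) : has_parity false a%:P.
Proof. by move=> [|i]; rewrite coefC. Qed.

Lemma has_parityXn n : has_parity (odd n) 'X^n.
Proof.
by move=> i hi; rewrite coefXn; case: (eqVneq i n) hi => // ->; rewrite eqxx.
Qed.

Lemma has_parityX : has_parity true 'X.
Proof. by have := @has_parityXn 1; rewrite expr1. Qed.

End Parity.

(** * Coefficients of polynomials and of their derivatives *)
Section TopCoefficients.
Variable R : nzRingType.
Implicit Types p : {poly R}.

Lemma size_le_drop p n : (size p <= n.+1)%N -> p`_n = 0 -> (size p <= n)%N.
Proof.
move=> sp pn; apply/leq_sizeP => j; rewrite leq_eqVlt => /predU1P[<-//|nj].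
exact: (leq_sizeP _ _ sp).
Qed.

Lemma coef_mulX2 p n : ('X^2 * p)`_n.+2 = p`_n.
Proof. by rewrite coefXnM/= subSS subSS subn0. Qed.

Lemma coef_mulX p n : ('X * p)`_n.+1 = p`_n.
Proof. by rewrite coefXM. Qed.

(** The Euler operators x d/dx and x^2 d^2/dx^2 act diagonally on monomials; reading
    coefficients after multiplication by a power of X therefore needs no separate
    treatment of small degrees. *)
Lemma coef_X_deriv p n : ('X * p^`())`_n = n%:R * p`_n.
Proof.
by case: n => [|n]; rewrite coefXM/= ?mul0r// coef_deriv mulr_natl.
Qed.

Lemma coef_X2_deriv2 p n : ('X^2 * p^`()^`())`_n = n%:R * (n%:R - 1) * p`_n.
Proof.
case: n => [|[|n]]; rewrite coefXnM/= ?mul0r// ?subrr ?mulr0 ?mul0r//.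
rewrite subSS subSS subn0 !coef_deriv -mulrnA.
have -> : n.+2%:R - 1 = n.+1%:R :> R by rewrite -natr1 addrK.
by rewrite -natrM mulr_natl mulnC.
Qed.

End TopCoefficients.

(** * Monic orthogonal polynomials for a linear functional *)
Section MonicOrthogonal.
Variables (R : realType) (L : {poly R} -> R).
Variables (P : nat -> {poly R}) (h b : nat -> R).
Hypothesis L_linear : linear (L : {poly R} -> R^o).
Hypothesis P_monic : forall n, P n \is monic /\ size (P n) = n.+1.
Hypothesis P_orth : forall i j, L (P i * P j) = h j * (i == j)%:R.
Hypothesis h_neq0 : forall n, h n != 0.
Hypothesis P_rec : recurrence_coeffs P b.
Implicit Types p q : {poly R}.

Lemma functionalD p q : L (p + q) = L p + L q.
Proof. by have := L_linear 1 p q; rewrite !scale1r. Qed.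

Lemma functional0 : L 0 = 0.
Proof. by apply: (addrI (L 0)); rewrite -functionalD !addr0. Qed.

Lemma functionalZ (a : R) p : L (a *: p) = a * L p.
Proof. by have := L_linear a p 0; rewrite !addr0 functional0 addr0. Qed.

Lemma functionalB p q : L (p - q) = L p - L q.
Proof. by rewrite functionalD -scaleN1r functionalZ mulN1r. Qed.

Lemma P_size n : size (P n) = n.+1.
Proof. by have [] := P_monic n. Qed.

Lemma P_lead n : (P n)`_n = 1.
Proof. by have [/monicP <- s] := P_monic n; rewrite lead_coefE s. Qed.

Lemma P_coef_gt n i : (n < i)%N -> (P n)`_i = 0.
Proof. by move=> ni; rewrite nth_default// P_size. Qed.

Lemma size_sub_lead p n :
  (size p <= n.+1)%N -> (size (p - p`_n *: P n)%R <= n)%N.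
Proof.
move=> sp; apply: size_le_drop; last by rewrite coefB coefZ P_lead mulr1 subrr.
rewrite (leq_trans (size_polyD _ _))// geq_max sp size_polyN.
by rewrite (leq_trans (size_scale_leq _ _))// P_size.
Qed.

Lemma P0E : P 0 = 1.
Proof.
have [m s] := P_monic 0%N; have /size1_polyC -> : (size (P 0) <= 1)%N by rewrite s.
by rewrite P_lead.
Qed.

Lemma orth_lower n p : (size p <= n)%N -> L (P n * p) = 0.
Proof.
suff: forall m, (m <= n)%N -> (size p <= m)%N -> L (P n * p) = 0.
  by move=> H sp; exact: (H n).
move=> m; elim: m p => [|m IH] p mn sp.
  by move: sp; rewrite leqn0 size_poly_eq0 => /eqP ->; rewrite mulr0 functional0.
rewrite -(subrK (p`_m *: P m) p) mulrDr functionalD IH;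
  [|exact: ltnW|exact: size_sub_lead].
by rewrite add0r -scalerAr functionalZ P_orth gtn_eqF// !mulr0.
Qed.

Lemma orth_top n p : (size p <= n.+1)%N -> L (P n * p) = p`_n * h n.
Proof.
move=> sp; rewrite -[in LHS](subrK (p`_n *: P n) p) mulrDr functionalD.
by rewrite orth_lower ?size_sub_lead// add0r -scalerAr functionalZ P_orth eqxx mulr1.
Qed.

(** The leading term of a nonzero p of degree d gives L(P_d p) = lead(p) h_d, which
    does not vanish. *)
Lemma orth_complete n p :
  (size p <= n)%N -> (forall j, (j < n)%N -> L (P j * p) = 0) -> p = 0.
Proof.
move=> sp Lp; apply/eqP; apply: contraT => p0.
have [d sd] : exists d, size p = d.+1.
  by exists (size p).-1; rewrite prednK// lt0n size_poly_eq0.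
have Lpd : L (P d * p) = 0 by apply: Lp; rewrite -sd.
move/eqP: Lpd; rewrite orth_top ?sd// mulf_eq0 (negbTE (h_neq0 d)) orbF.
by rewrite -[d]/(d.+1.-1) -sd -lead_coefE lead_coef_eq0 (negbTE p0).
Qed.

Lemma mulXP n : 'X * P n = P n.+1 + b n *: prev_poly P n.
Proof. by have [_ ->] := P_rec. Qed.

Lemma rec_coeff0 : b 0 = 0. Proof. by have [] := P_rec. Qed.

(** The recurrence has no term in P_n itself, which is all that the evenness of the
    weight contributes to the algebra. *)
Lemma P_parity n : has_parity (odd n) (P n).
Proof.
suff [] : has_parity (odd n) (P n) /\ has_parity (odd n.+1) (P n.+1) by [].
have step m : P m.+1 = 'X * P m - b m *: prev_poly P m by rewrite mulXP addrK.
elim: n => [|n [IH1 IH2]]; [split|split=> //].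
- by rewrite P0E; exact: has_parityC.
- rewrite step/= rec_coeff0 scale0r subr0.
  by apply: (has_parityM (c := true) (d := false));
    [exact: has_parityX|rewrite P0E; exact: has_parityC].
- rewrite step; apply: has_parityB.
    by rewrite -[odd n.+2]/(true (+) odd n.+1); apply: has_parityM => //;
       exact: has_parityX.
  by apply: has_parityZ; rewrite /= negbK.
Qed.

(** An odd polynomial is a combination of the P_j with j odd, and L(P_j) = L(P_j P_0)
    vanishes for those. *)
Lemma L_odd p : has_parity true p -> L p = 0.
Proof.
suff: forall m, (size p <= m)%N -> has_parity true p -> L p = 0.
  by apply; exact: leqnn.
move=> m; elim: m p => [|m IH] p sp hp.
  by move: sp; rewrite leqn0 size_poly_eq0 => /eqP ->; rewrite functional0.
have [om|om] := boolP (odd m); last first.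
  by apply: IH => //; apply: size_le_drop => //; apply: hp; rewrite (negbTE om).
rewrite -(subrK (p`_m *: P m) p) functionalD IH ?size_sub_lead//; last first.
  by apply/has_parityB => //; apply/has_parityZ; have := @P_parity m; rewrite om.
rewrite add0r functionalZ -[P m]mulr1 -P0E P_orth.
by case: m om {IH sp} => // m _; rewrite /= !mulr0.
Qed.

Notation s := (subleading P).

Lemma coef_X2P n : ('X^2 * P n)`_n = s n.
Proof. by rewrite coefXnM /subleading. Qed.

Lemma subleadingSS n : s n.+2 = (P n.+2)`_n.
Proof. by rewrite /subleading/= subSS subSS subn0. Qed.

(** Comparison of the coefficients of degree n-1 in the recurrence. *)
Lemma subleading_rec n : s n.+1 = s n - b n.
Proof.
case: n => [|n]; first by rewrite /subleading/= rec_coeff0 subrr.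
have /(congr1 (fun p => p`_n)) := mulXP n.+1; rewrite coefD coefZ /= P_lead mulr1.
by rewrite -coef_mulX mulrA -expr2 coef_X2P -subleadingSS => ->; rewrite addrK.
Qed.

Lemma h_rec n : h n.+1 = b n.+1 * h n.
Proof.
have : L ('X * P n.+1 * P n) = b n.+1 * h n.
  rewrite mulXP/= mulrDl functionalD -scalerAl functionalZ !P_orth eqxx mulr1.
  by rewrite gtn_eqF// mulr0 add0r.
have -> : 'X * P n.+1 * P n = P n.+1 * ('X * P n) by ring.
rewrite orth_top; last by rewrite mulrC size_mulX ?P_size// -size_poly_eq0 P_size.
by rewrite coef_mulX P_lead mul1r.
Qed.

(** Subtracting p_(n+2) P_(n+2) removes the top term without changing the integral;
    what is left has degree at most n. *)
Lemma orth_top2 n p : (size p <= n.+3)%N -> p`_n.+1 = 0 ->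
  L (P n * p) = (p`_n - p`_n.+2 * s n.+2) * h n.
Proof.
move=> sp pn1; rewrite -[in LHS](subrK (p`_n.+2 *: P n.+2) p) mulrDr functionalD.
rewrite -scalerAr functionalZ P_orth ltn_eqF// !mulr0 addr0 orth_top; last first.
  apply: size_le_drop; first exact: size_sub_lead.
  by rewrite coefB coefZ pn1 P_parity ?mulr0 ?subr0//=; case: odd.
by rewrite coefB coefZ subleadingSS.
Qed.

Variables alpha beta k : R.
(* t3, t1 are the coefficients of T, and m2, l1, u2, u0 those of M_n, L_n, U_n that
   are not named elsewhere; the digit is the degree.  The coefficient of x^2 in Y is
   - y2. *)
Let K : R := k ^+ 2.
Let t3 : R := 2 * K * (alpha + beta + 2).
Let t1 : R := - 2 * (1 + K + alpha + beta * K).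
Let y2 : R := 1 + K.

(** The factor (1 - x^2)(1 - k^2 x^2), expanded. *)
Definition poly_Y : {poly R} := K%:P * 'X^4 - y2%:P * 'X^2 + 1.
(** The polynomial T of the Pearson equation (Y w)' = T w. *)
Definition poly_T : {poly R} := t3%:P * 'X^3 + t1%:P * 'X.

Hypothesis pearson : forall p, L (p^`() * poly_Y + p * poly_T) = 0.

Let m2 n : R := - 2 * (alpha + beta + n%:R + 1 / 2) * K.
Let c := odeC alpha beta k P b.
Let l1 n : R := 2 * K * (alpha + beta + n%:R + 1 / 2) * b n
  - n%:R * (1 + K) - 2 * K * s n.
Let u2 n : R := - K * n%:R * (n%:R + 2 * alpha + 2 * beta + 3).
Let u0 n : R := 2 * K * (2 * n%:R + 2 * alpha + 2 * beta + 1) * (s n - b n)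
  + n%:R * K * (n%:R + 2 * beta + 1) + n%:R * (n%:R + 2 * alpha + 1).
Let q n : {poly R} := b n *: prev_poly P n.

Definition poly_M n : {poly R} := (m2 n)%:P * 'X^2 - (c n)%:P.
Definition poly_L n : {poly R} := (n%:R * K)%:P * 'X^3 + (l1 n)%:P * 'X.
Definition poly_U n : {poly R} := (u2 n)%:P * 'X^2 + (u0 n)%:P.

(** Multiplication by X aligns the degree of q with that of P_n, so that n = 0, where
    q = 0 and b_0 = 0, needs no separate statement. *)
Lemma coef_Xq n i : (n <= i)%N -> ('X * q n)`_i = b n * (i == n)%:R.
Proof.
rewrite /q; case: n => [|n] ni; first by rewrite rec_coeff0 scale0r mulr0 coef0 mul0r.
rewrite -scalerAr coefZ; case: i ni => // i ni; rewrite coef_mulX/= eqSS.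
move: ni; rewrite ltnS leq_eqVlt => /predU1P[->|ni].
  by rewrite P_lead eqxx.
by rewrite P_coef_gt// gtn_eqF.
Qed.

Lemma q_parity n : has_parity (~~ odd n) (q n).
Proof.
rewrite /q; case: n => [|n]; first by rewrite rec_coeff0 scale0r; exact: has_parity0.
by apply: has_parityZ; rewrite /= negbK; exact: P_parity.
Qed.

Lemma Y_parity : has_parity false poly_Y.
Proof.
apply: has_parityD; last exact: has_parityC.
apply: has_parityB.
- by apply: (has_parityM (c := false) (d := false));
    [exact: has_parityC|exact: (@has_parityXn _ 4)].
- by apply: (has_parityM (c := false) (d := false));
    [exact: has_parityC|exact: (@has_parityXn _ 2)].
Qed.

Lemma odd_cubic_parity (u v : R) : has_parity true (u%:P * 'X^3 + v%:P * 'X).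
Proof.
apply: has_parityD.
- by apply: (has_parityM (c := false) (d := true));
    [exact: has_parityC|exact: (@has_parityXn _ 3)].
- by apply: (has_parityM (c := false) (d := true));
    [exact: has_parityC|exact: has_parityX].
Qed.

Lemma even_quadratic_parity (u v : R) : has_parity false (u%:P * 'X^2 + v%:P).
Proof.
apply: has_parityD; last exact: has_parityC.
by apply: (has_parityM (c := false) (d := false));
  [exact: has_parityC|exact: (@has_parityXn _ 2)].
Qed.

(** * The first-order relation *)
Definition structure_defect n : {poly R} :=
  poly_Y * (P n)^`() - poly_L n * P n - poly_M n * q n.

Lemma X_structure_defect n : 'X * structure_defect n =
  K%:P * ('X^2 * ('X^2 * ('X * (P n)^`()))) - y2%:P * ('X^2 * ('X * (P n)^`()))
  + 'X * (P n)^`() - (n%:R * K)%:P * ('X^2 * ('X^2 * P n))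
  - (l1 n)%:P * ('X^2 * P n) - (m2 n)%:P * ('X^2 * ('X * q n))
  + (c n)%:P * ('X * q n).
Proof. rewrite /structure_defect /poly_Y /poly_L /poly_M; ring. Qed.

Lemma defect_parity n : has_parity (~~ odd n) (structure_defect n).
Proof.
apply: has_parityB; first apply: has_parityB.
- have := has_parityM Y_parity (has_parity_deriv (@P_parity n)).
  by rewrite addFb.
- have := has_parityM (odd_cubic_parity (n%:R * K) (l1 n)) (@P_parity n).
  by rewrite addTb.
- have := has_parityM (even_quadratic_parity (m2 n) (- c n)) (@q_parity n).
  by rewrite addFb polyCN.
Qed.

(** The Euler operator theta = x d/dx multiplies the coefficient of degree n - 2 by
    n - 2; for n < 2 both sides are 0 by the convention on s. *)
Lemma subleading_theta n : ('X^2 * ('X * (P n)^`()))`_n = (n%:R - 2) * s n.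
Proof.
rewrite /subleading; case: n => [|[|n]]; rewrite coefXnM/= ?mulr0//.
by rewrite coef_X_deriv subSS subSS subn0 -[n.+2]addn2 natrD addrK.
Qed.

Lemma subleading_theta2 n :
  ('X^2 * ('X^2 * (P n)^`()^`()))`_n = (n%:R - 2) * (n%:R - 3) * s n.
Proof.
rewrite /subleading; case: n => [|[|n]]; rewrite coefXnM/= ?mulr0//.
rewrite coef_X2_deriv2 subSS subSS subn0 -[n.+2]addn2 natrD.
congr (_ * _); ring.
Qed.

(** The degrees n+3 and n+1 are computed; n+2 and n vanish by parity. *)
Lemma defect_size n : (size (structure_defect n) <= n)%N.
Proof.
apply/leq_sizeP => i ni.
have [oi|oi] := eqVneq (odd i) (~~ odd n); last exact: defect_parity oi.
rewrite -coef_mulX X_structure_defect.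
(* Degree n + 1: this cancellation fixes the linear term of L_n. *)
have [->|i1] := eqVneq i n.+1.
  rewrite !(coefD, coefN, coefCM) !coef_mulX2 !coef_X2P !coef_X_deriv P_lead.
  rewrite (@P_coef_gt n n.+2)//.
  rewrite subleading_theta.
  rewrite (@coef_Xq n n)// (@coef_Xq n n.+2) ?eqxx ?gtn_eqF//; last by lia.
  rewrite mulr1n mulr0n /l1 /m2 /y2; ring.
have [j ij nj] : exists2 j, i = j.+3 & (n <= j)%N.
  have i2 : i != n by apply/eqP => E; move: oi; rewrite E; case: odd.
  have i3 : i != n.+2 by apply/eqP => E; move: oi; rewrite E/=; case: odd.
  by exists (i - 3)%N; lia.
rewrite ij !(coefD, coefN, coefCM) !coef_mulX2 !coef_X_deriv.
rewrite (@P_coef_gt n j.+2) ?ltnS ?leqW// (@P_coef_gt n j.+4) ?ltnS ?leqW//.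
rewrite (@coef_Xq n j.+2) ?leqW// (@coef_Xq n j.+4) ?leqW// !gtn_eqF ?ltnS ?leqW//.
rewrite mulr0n.
have [->|jn] := eqVneq j n; first by rewrite P_lead; ring.
rewrite P_coef_gt; [ring|by rewrite ltn_neqAle eq_sym jn].
Qed.

(** The Pearson identity for P_n P_j: integration by parts. *)
Lemma pearson_swap j n :
  L (P j * (poly_Y * (P n)^`())) =
  - L (P n * (poly_Y * (P j)^`() + poly_T * P j)).
Proof.
apply/eqP; rewrite -subr_eq0 opprK -functionalD; apply/eqP.
rewrite -(pearson (P n * P j)) derivM; congr L; ring.
Qed.

(** Both sides are minus L(Y p' r'), by the Pearson identity for p r' and for p' r. *)
Lemma pearson_symmetric p r :
  L (p * (poly_Y * r^`()^`() + poly_T * r^`())) =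
  L (r * (poly_Y * p^`()^`() + poly_T * p^`())).
Proof.
apply/eqP; rewrite -subr_eq0 -functionalB; apply/eqP.
have h1 := pearson (p * r^`()); have h2 := pearson (p^`() * r).
rewrite -[RHS](subrr 0) -{1}h1 -h2 -functionalB !derivM; congr L; ring.
Qed.

(** Up to sign, the polynomial that is tested against P_n once the derivative has been
    moved from P_n to P_j in L(P_j (Y P_n' - L_n P_n)). *)
Definition dual_defect n j : {poly R} :=
  poly_Y * (P j)^`() + (poly_T + poly_L n) * P j.

Lemma X_dual_defect n j : 'X * dual_defect n j =
  K%:P * ('X^2 * ('X^2 * ('X * (P j)^`()))) - y2%:P * ('X^2 * ('X * (P j)^`()))
  + 'X * (P j)^`() + (t3 + n%:R * K)%:P * ('X^2 * ('X^2 * P j))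
  + (t1 + l1 n)%:P * ('X^2 * P j).
Proof. rewrite /dual_defect /poly_Y /poly_L /poly_T !polyCD; ring. Qed.

Lemma dual_parity n j : has_parity (~~ odd j) (dual_defect n j).
Proof.
apply: has_parityD.
- have := has_parityM Y_parity (has_parity_deriv (@P_parity j)).
  by rewrite addFb.
- rewrite -addTb; apply: has_parityM (@P_parity j).
  by apply: has_parityD; exact: odd_cubic_parity.
Qed.

Lemma dual_size n j : (size (dual_defect n j) <= j.+4)%N.
Proof.
apply/leq_sizeP => i ji; rewrite -coef_mulX X_dual_defect.
case: i ji => [|[|[|[|i]]]]// ji; rewrite !ltnS in ji.
rewrite !(coefD, coefN, coefCM) !coef_mulX2 !coef_X_deriv.
by rewrite !P_coef_gt ?ltnS ?leqW//; ring.
Qed.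

Lemma coef_dual_top n j :
  (dual_defect n j)`_j.+3 = j%:R * K + t3 + n%:R * K.
Proof.
rewrite -coef_mulX X_dual_defect !(coefD, coefN, coefCM) !coef_mulX2.
rewrite !coef_X_deriv P_lead (@P_coef_gt j j.+2) ?ltnS ?leqW//.
rewrite (@P_coef_gt j j.+4) ?ltnS ?leqW//.
ring.
Qed.

Lemma coef_dual_next n j : (dual_defect n j)`_j.+1 =
  K * ((j%:R - 2) * s j) - y2 * j%:R + (t3 + n%:R * K) * s j + (t1 + l1 n).
Proof.
rewrite -coef_mulX X_dual_defect !(coefD, coefN, coefCM) !coef_mulX2.
rewrite coef_X2P subleading_theta !coef_X_deriv P_lead (@P_coef_gt j j.+2) ?ltnS ?leqW//.
ring.
Qed.

Lemma MP_size n j : (size (poly_M n * P j)%R <= j.+3)%N.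
Proof.
rewrite (leq_trans (size_polyMleq _ _))// P_size addnS/= -[j.+3]add3n leq_add2r.
rewrite /poly_M (leq_trans (size_polyD _ _))// geq_max size_polyN.
rewrite (leq_trans (size_polyC_leq1 _))// andbT mul_polyC.
by rewrite (leq_trans (size_scale_leq _ _))// size_polyXn.
Qed.

Lemma coef_MP_top n j : (poly_M n * P j)`_j.+2 = m2 n.
Proof.
rewrite /poly_M mulrBl -mulrA coefB !coefCM coef_mulX2 P_lead.
by rewrite P_coef_gt// mulr0 subr0 mulr1.
Qed.

Lemma coef_MP n j : (poly_M n * P j)`_j = m2 n * s j - c n.
Proof.
by rewrite /poly_M mulrBl -mulrA coefB !coefCM coef_X2P P_lead mulr1.
Qed.

Lemma MP_parity n j : has_parity (odd j) (poly_M n * P j).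
Proof.
have := has_parityM (even_quadratic_parity (m2 n) (- c n)) (@P_parity j).
by rewrite addFb polyCN.
Qed.

(** Only j = n-1 and j = n-3 survive parity and degree.  The case j = n-3 compares
    leading coefficients, and j = n-1 is where the value of C_n is needed. *)
Lemma structure_defect_orth n j : (j < n)%N -> L (P j * structure_defect n) = 0.
Proof.
move=> jn; have [oj|oj] := eqVneq (odd j) (odd n).
  apply: L_odd; have := has_parityM (@P_parity j) (@defect_parity n).
  by rewrite oj addbN addbb.
have -> : L (P j * structure_defect n) =
    - L (P n * dual_defect n j) - L (q n * (poly_M n * P j)).
  rewrite /structure_defect !mulrBr !functionalB pearson_swap /dual_defect.
  rewrite -opprD -functionalD.
  have -> : P j * (poly_M n * q n) = q n * (poly_M n * P j) by ring.
  by do ![congr (_ - _)|congr (- _)]; congr L; ring.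
have orth_q m p : n = m.+1 -> L (q n * p) = b n * L (P m * p).
  by move=> ->; rewrite /q/= -scalerAl functionalZ.
have [n1|[n3|n4]] : n = j.+1 \/ n = j.+3 \/ (j.+4 <= n)%N.
  have n2 : n != j.+2 by apply/eqP => E; move: oj; rewrite E/= negbK eqxx.
  by lia.
- rewrite (orth_q j)// n1 orth_top2 ?dual_size//; last first.
    by apply: dual_parity; rewrite /= negbK; case: odd.
  rewrite orth_top2 ?MP_size//; last by apply: MP_parity => /=; case: odd.
  rewrite coef_dual_next coef_dual_top coef_MP coef_MP_top h_rec.
  rewrite /c /odeC /l1 /m2 /t3 /t1 /y2 !subleading_rec -/K.
  have -> : j.+1%:R = j%:R + 1 :> R by rewrite natr1.
  by field.
- rewrite (orth_q j.+2)// n3 !orth_top ?dual_size ?MP_size//.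
  rewrite coef_dual_top coef_MP_top h_rec /m2 /t3.
  have -> : j.+3%:R = j%:R + 3 :> R by rewrite -natrD addn3.
  by field.
- case: n {jn oj} n4 orth_q => // n jn orth_q.
  rewrite (orth_q n)// !orth_lower ?mulr0 ?subr0 ?oppr0//.
    by apply: leq_trans (MP_size _ _) _; rewrite -ltnS.
  exact: leq_trans (dual_size _ _) jn.
Qed.

(** The lowering relation: P_n' in terms of P_n and P_(n-1) alone, since q_n is a
    multiple of P_(n-1). *)
Lemma structure_relation n :
  poly_Y * (P n)^`() = poly_L n * P n + poly_M n * q n.
Proof.
apply/eqP; rewrite -subr_eq0 opprD addrA; apply/eqP.
apply: (@orth_complete n); first exact: defect_size.
by move=> j jn; exact: structure_defect_orth.
Qed.

(** * The second-order relation *)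
Definition ode_defect n : {poly R} :=
  poly_Y * (P n)^`()^`() + poly_T * (P n)^`() + poly_U n * P n
  - (2 * m2 n)%:P * ('X * q n).

(** For j = n this is the left side of the second-order relation.  For j < n it is
    what the symmetry of the Pearson operator leaves against P_n. *)
Definition dual_ode n j : {poly R} :=
  poly_Y * (P j)^`()^`() + poly_T * (P j)^`() + poly_U n * P j.

Lemma X2_dual_ode n j : 'X^2 * dual_ode n j =
  K%:P * ('X^2 * ('X^2 * ('X^2 * (P j)^`()^`())))
  - y2%:P * ('X^2 * ('X^2 * (P j)^`()^`())) + 'X^2 * (P j)^`()^`()
  + t3%:P * ('X^2 * ('X^2 * ('X * (P j)^`()))) + t1%:P * ('X^2 * ('X * (P j)^`()))
  + (u2 n)%:P * ('X^2 * ('X^2 * P j)) + (u0 n)%:P * ('X^2 * P j).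
Proof. rewrite /dual_ode /poly_Y /poly_T /poly_U; ring. Qed.

Lemma coef_dual_ode n j i : (j <= i)%N -> (dual_ode n j)`_i.+2 =
  (K * (i%:R * (i%:R - 1)) + t3 * i%:R + u2 n) * (i == j)%:R.
Proof.
move=> ji; rewrite -coef_mulX2 X2_dual_ode; have := coef_X2_deriv2 (P j).
(* Generalized, so that the product X^2 P_j'' is not itself split by coef_mulX2. *)
move: ('X^2 * (P j)^`()^`()) => phi phiE.
rewrite !(coefD, coefN, coefCM) !coef_mulX2 !coef_X_deriv !phiE.
rewrite (@P_coef_gt j i.+2) ?ltnS ?leqW// (@P_coef_gt j i.+4) ?ltnS ?leqW//.
have [->|ij] := eqVneq i j; first by rewrite P_lead mulr1n; ring.
rewrite P_coef_gt; last by rewrite ltn_neqAle eq_sym ij.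
by rewrite mulr0n; ring.
Qed.

Lemma coef_dual_ode_mid n j : (dual_ode n j)`_j =
  K * ((j%:R - 2) * (j%:R - 3) * s j) - y2 * (j%:R * (j%:R - 1))
  + t3 * ((j%:R - 2) * s j) + t1 * j%:R + u2 n * s j + u0 n.
Proof.
rewrite -coef_mulX2 X2_dual_ode.
have := coef_X2_deriv2 (P j); have := subleading_theta2 j.
move: ('X^2 * (P j)^`()^`()) => phi phi_s phiE.
rewrite !(coefD, coefN, coefCM) !coef_mulX2 coef_X2P subleading_theta phi_s.
rewrite !coef_X_deriv !phiE P_lead (@P_coef_gt j j.+2) ?ltnS ?leqW//.
ring.
Qed.

Lemma dual_ode_parity n j : has_parity (odd j) (dual_ode n j).
Proof.
have dP := has_parity_deriv (@P_parity j).
apply: has_parityD; first apply: has_parityD.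
- by have := has_parityM Y_parity (has_parity_deriv dP); rewrite addFb negbK.
- by have := has_parityM (odd_cubic_parity t3 t1) dP; rewrite addTb negbK.
- by have := has_parityM (even_quadratic_parity (u2 n) (u0 n)) (@P_parity j); rewrite addFb.
Qed.

Lemma dual_ode_size n j : (size (dual_ode n j) <= j.+3)%N.
Proof.
apply/leq_sizeP => -[|[|i]]// ji; rewrite !ltnS in ji.
by rewrite coef_dual_ode ?(ltnW ji)// gtn_eqF// mulr0.
Qed.

Lemma Xq_parity n : has_parity (odd n) ((2 * m2 n)%:P * ('X * q n)).
Proof.
have := has_parityM (@has_parityX R) (@q_parity n).
move=> /(has_parityM (has_parityC (2 * m2 n))).
by rewrite addFb addTb negbK.
Qed.

Lemma ode_defect_parity n : has_parity (odd n) (ode_defect n).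
Proof. by apply: has_parityB; [exact: dual_ode_parity|exact: Xq_parity]. Qed.

Lemma ode_defect_size n : (size (ode_defect n) <= n)%N.
Proof.
apply/leq_sizeP => i ni.
have [oi|oi] := eqVneq (odd i) (odd n); last exact: ode_defect_parity oi.
rewrite /ode_defect -/(dual_ode n n) coefB coefCM coef_Xq//.
(* Degree n: this cancellation fixes the constant term of U_n. *)
have [->|i1] := eqVneq i n.
  by rewrite coef_dual_ode_mid mulr1n /t3 /t1 /y2 /u2 /u0 /m2; field.
have [j ij nj] : exists2 j, i = j.+2 & (n <= j)%N.
  have i3 : i != n.+1 by apply/eqP => E; move: oi; rewrite E/=; case: odd.
  by exists (i - 2)%N; lia.
rewrite ij coef_dual_ode// mulr0n !mulr0 subr0.
have [->|_] := eqVneq j n; last by rewrite mulr0.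
by rewrite /t3 /u2; ring.
Qed.

(** Only j = n-2 survives parity and degree. *)
Lemma ode_defect_orth n j : (j < n)%N -> L (P j * ode_defect n) = 0.
Proof.
move=> jn; have [oj|oj] := eqVneq (odd j) (~~ odd n).
  apply: L_odd; have := has_parityM (@P_parity j) (@ode_defect_parity n).
  by rewrite oj addNb addbb.
have -> : L (P j * ode_defect n) =
    L (P n * dual_ode n j) - 2 * m2 n * L (q n * ('X * P j)).
  rewrite /ode_defect mulrBr functionalB mulrDr functionalD pearson_symmetric.
  rewrite -functionalZ.
  by rewrite /dual_ode -mul_polyC -functionalD; congr (L _ - L _); ring.
have size_XP i : (size ('X * P i)%R <= i.+2)%N.
  by rewrite mulrC size_mulX ?P_size// -size_poly_eq0 P_size.
have orth_q m p : n = m.+1 -> L (q n * p) = b n * L (P m * p).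
  by move=> ->; rewrite /q/= -scalerAl functionalZ.
have [n2|n3] : n = j.+2 \/ (j.+3 <= n)%N.
  have n1 : n != j.+1 by apply/eqP => E; move: oj; rewrite E/= negbK eqxx.
  by lia.
- rewrite (orth_q j.+1)// n2 !orth_top ?dual_ode_size ?size_XP//.
  rewrite coef_dual_ode// eqxx coef_mulX P_lead mulr1n h_rec /m2 /t3 /u2.
  have -> : j.+2%:R = j%:R + 2 :> R by rewrite -natrD addn2.
  by field.
- case: n {jn oj} n3 orth_q => // n jn orth_q.
  rewrite (orth_q n)// !orth_lower ?mulr0 ?subr0//.
    by apply: leq_trans (size_XP _) _; rewrite -ltnS.
  exact: leq_trans (dual_ode_size _ _) jn.
Qed.

(** The factor of q_n on the right is the derivative of M_n. *)
Lemma polynomial_ode n :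
  poly_Y * (P n)^`()^`() + poly_T * (P n)^`() + poly_U n * P n
  = (2 * m2 n)%:P * ('X * q n).
Proof.
apply/eqP; rewrite -subr_eq0; apply/eqP.
apply: (@orth_complete n); first exact: ode_defect_size.
by move=> j jn; exact: ode_defect_orth.
Qed.

End MonicOrthogonal.

(** * Integrals of functions unbounded at the endpoints *)

Section ImproperIntegral.
Variable R : realType.
Notation mu := (@lebesgue_measure R).
Implicit Types (f F : R -> R) (a b : R).

(** The integral of f from a to x is continuous up to the endpoints because f is
    integrable, and has derivative f inside.  By the mean value theorem it therefore
    differs from F by a constant, although f may be unbounded at a and b. *)
Lemma integrable_FTC2 f F a b : a < b ->
  mu.-integrable `[a, b] (EFin \o f) ->
  {in `]a, b[, continuous f} ->
  (forall x, x \in `]a, b[ -> is_derive x 1 F (f x)) ->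
  {within `[a, b], continuous F} ->
  \int[mu]_(x in `[a, b]) f x = F b - F a.
Proof.
move=> ab intf cf dF cF.
pose G x := \int[mu]_(t in `[a, x]) f t.
have cG : {within `[a, b], continuous G}.
  exact: parameterized_integral_continuous (ltW ab) intf.
have dFG x : x \in `]a, b[ -> is_derive x 1 (F - G) 0.
  move=> xab; have /[!in_itv]/andP[ax xb] := xab.
  have [dG G'f] := continuous_FTC1_closed xb intf ax (cf _ xab).
  have dGx : is_derive x 1 G (f x).
    by apply: DeriveDef; [exact: dG|rewrite -derive1E; exact: G'f].
  by have dFx := dF x xab; rewrite -(subrr (f x)); exact: is_deriveB.
have cFG : {within `[a, b], continuous (F - G)}.
  exact: within_continuousB.
have [c _] := MVT ab dFG cFG.
rewrite mul0r !fctE /G set_itv1 Rintegral_set1.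
by move=> e; apply/esym/eqP; rewrite -subr_eq0 -e; apply/eqP; ring.
Qed.

(** The integral of f over a compact subinterval is a difference of two values of F,
    hence at most 2 |M|; monotone convergence carries the bound to ]a, b[. *)
Lemma integrable_bounded_primitive f F a b (M : R) :
  (forall x, x \in `]a, b[ -> 0 <= f x) ->
  {in `]a, b[, continuous f} ->
  (forall x, x \in `]a, b[ -> is_derive x 1 F (f x)) ->
  (forall x, x \in `]a, b[ -> `|F x| <= M) ->
  mu.-integrable `]a, b[ (EFin \o f).
Proof.
move=> f0 cf dF FM.
pose I (n : nat) : set R := `[a + n.+1%:R^-1, b - n.+1%:R^-1]%classic.
have Isub n : I n `<=` `]a, b[.
  apply: subset_itvSoo; rewrite bnd_simp.
    by rewrite ltrDl invr_gt0.
  by rewrite gtrBl invr_gt0.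
have UI : \bigcup_n I n = `]a, b[%classic.
  apply/seteqP; split=> [x [n _]|x]; first exact: Isub.
  rewrite /= in_itv/= => /andP[ax xb].
  have xa0 : 0 < x - a by rewrite subr_gt0.
  have bx0 : 0 < b - x by rewrite subr_gt0.
  have e0 : 0 < Num.min (x - a) (b - x) by rewrite lt_min xa0.
  have [n ne] := ltr_add_invr e0.
  move: ne; rewrite add0r lt_min => /andP[n1 n2].
  exists n => //; rewrite /I/= in_itv/= lerBrDl (addrC _^-1).
  by move: n1 n2; rewrite !ltrBrDr => /ltW + /ltW; rewrite addrC [a + _]addrC => -> ->.
have mf : measurable_fun `]a, b[ f.
  by apply: open_continuous_measurable_fun => // x; rewrite inE; exact: cf.
have mI n : measurable (I n) by exact: measurable_itv.
have nd : nondecreasing_seq I.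
  apply/nondecreasing_seqP => n; rewrite subsetEset.
  apply: subset_itvScc; rewrite bnd_simp.
    by rewrite lerD2l lef_pV2 ?posrE ?ler_nat.
  by rewrite lerD2l lerN2 lef_pV2 ?posrE ?ler_nat.
have bound n : (\int[mu]_(x in I n) (f x)%:E <= (2 * `|M|)%:E)%E.
  have [anbn|] := ltP (a + n.+1%:R^-1) (b - n.+1%:R^-1); last first.
    have M0 : (0%:E <= (2 * `|M|)%:E)%E by rewrite lee_fin mulr_ge0.
    rewrite le_eqVlt => /predU1P[|] h; last first.
      by rewrite /I set_itv_ge ?integral_set0// bnd_simp -ltNge.
    by rewrite /I h set_itv1 integral_set1.
  have sub x : x \in `[a + n.+1%:R^-1, b - n.+1%:R^-1] -> x \in `]a, b[.
    by move=> xI; exact: (Isub n x xI).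
  have int : mu.-integrable (I n) (EFin \o f).
    apply: continuous_compact_integrable; first exact: segment_compact.
    by apply: continuous_in_subspaceT => x; rewrite inE => /sub; exact: cf.
  have sub' x : x \in `]a + n.+1%:R^-1, b - n.+1%:R^-1[ -> x \in `]a, b[.
    by move=> xI; apply: sub; apply: subset_itv_oo_cc xI.
  have fin : (\int[mu]_(x in I n) (f x)%:E)%E \is a fin_num.
    by apply: integrable_fin_num int; exact: mI.
  have -> : (\int[mu]_(x in I n) (f x)%:E)%E =
      (F (b - n.+1%:R^-1) - F (a + n.+1%:R^-1))%:E.
    have cf' : {in `]a + n.+1%:R^-1, b - n.+1%:R^-1[, continuous f}.
      by move=> x /sub'; exact: cf.
    have cF : {within `[a + n.+1%:R^-1, b - n.+1%:R^-1], continuous F}.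
      apply: derivable_within_continuous => x /sub xab.
      by have dFx := dF _ xab; exact: ex_derive.
    have dF' x : x \in `]a + n.+1%:R^-1, b - n.+1%:R^-1[ ->
        is_derive x 1 F (f x) by move=> /sub'; exact: dF.
    by rewrite -(fineK fin) -(integrable_FTC2 anbn int cf' dF' cF).
  rewrite lee_fin (le_trans (ler_norm _))// (le_trans (ler_normB _ _))//.
  rewrite mulr_natl mulr2n lerD// (le_trans _ (ler_norm M))// FM// sub//.
    by rewrite bound_itvE ltW.
  by rewrite bound_itvE ltW.
apply/integrableP; split; first exact/measurable_EFinP.
rewrite [X in (X < _)%E](_ : _ = (\int[mu]_(x in `]a, b[) (f x)%:E)%E); last first.
  by apply: eq_integral => x /[!inE] xab /=; rewrite ger0_norm// f0.
have mfI n : measurable_fun (I n) (EFin \o f).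
  by apply/measurable_EFinP; apply: measurable_funS mf.
have f0I n x : I n x -> (0 <= (EFin \o f) x)%E.
  by move=> /Isub xab; rewrite lee_fin f0.
have cvgI : (\int[mu]_(x in I n) (EFin \o f) x @[n --> \oo] -->
    \int[mu]_(x in \bigcup_n I n) (EFin \o f) x)%E.
  exact: ge0_nondecreasing_set_cvg_integral.
rewrite UI in cvgI; rewrite -(cvg_lim _ cvgI)//.
apply: (@le_lt_trans _ _ (2 * `|M|)%:E); last exact: ltry.
by apply: lime_le; [apply/cvg_ex; eexists; exact: cvgI|exact: nearW].
Qed.

End ImproperIntegral.

(** * Real powers *)

Section PowerFunctions.
Variable R : realType.
Implicit Types (x y r : R).

(** The power function is monotone, increasing or decreasing according to the sign of
    r; the sum bounds it in both cases. *)
Lemma powR_le_endpoints r (m M y : R) : 0 < m -> m <= y <= M ->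
  y `^ r <= m `^ r + M `^ r.
Proof.
move=> m0 /andP[my yM]; have y0 := lt_le_trans m0 my.
have M0 := lt_le_trans y0 yM.
have [r0|r0] := leP 0 r.
  apply: (@le_trans _ _ (M `^ r)); last by rewrite lerDr powR_ge0.
  by apply: ge0_ler_powR; rewrite ?nnegrE ?(ltW y0) ?(ltW M0).
have powV z : z `^ r = (z `^ (- r))^-1 by rewrite powRN invrK.
apply: (@le_trans _ _ (m `^ r)); last by rewrite lerDl powR_ge0.
rewrite (powV y) (powV m) lef_pV2 ?posrE ?powR_gt0//.
by apply: ge0_ler_powR => //; rewrite ?oppr_ge0 ?nnegrE ltW.
Qed.

Lemma mulr_powR r y : -1 < r -> 0 <= y -> y * y `^ r = y `^ (r + 1).
Proof. by move=> r1 y0; rewrite -[X in y `^ X](addrK 1) mulr_powRB1//; lra. Qed.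

(** Positivity along the filter is required because the power of a negative number
    is 1 by convention, so that y `^ r is only right-continuous at 0. *)
Lemma cvg_powR0 (T : Type) (F : set_system T) (u : T -> R) r : Filter F ->
  0 < r -> u @ F --> 0 -> (\forall t \near F, 0 < u t) ->
  u t `^ r @[t --> F] --> 0.
Proof.
move=> FF r0 u0 up; apply/cvgrPdist_lt => e e0.
have /cvgrPdist_lt/(_ e e0) := powR_cvg0 r0.
by move=> /u0; apply: filterS2 up => t ut; exact.
Qed.

Lemma is_derive_powR (u : R -> R) du r x : 0 < u x -> is_derive x 1 u du ->
  is_derive x 1 (fun y => u y `^ r) (r * u x `^ (r - 1) * du).
Proof.
by move=> ux0 dux; apply: (@is_derive1_comp _ (fun z => z `^ r));
   exact: is_derive1_powR.
Qed.

(** This form of the modulus makes the logarithmic derivative computable without a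
    case distinction on the sign of y. *)
Lemma powR_norm_sqr y r : `|y| `^ r = (y ^+ 2) `^ (r / 2).
Proof.
by rewrite -real_normK ?num_real// -powR_mulrn// -powRrM mulrCA divff ?mulr1.
Qed.

Lemma is_derive_powR_norm (u : R -> R) du r x : u x != 0 ->
  is_derive x 1 u du ->
  is_derive x 1 (fun y => `|u y| `^ r) (r * du / u x * `|u x| `^ r).
Proof.
move=> ux0 dux; rewrite (_ : (fun y => _) = fun y => (u y ^+ 2) `^ (r / 2)); last first.
  by apply/funext => y; exact: powR_norm_sqr.
have u2 : 0 < u x ^+ 2 by rewrite exprn_even_gt0.
have du2 : is_derive x 1 (fun y => u y ^+ 2) (u x * du + u x * du).
  by have := is_deriveM dux dux; rewrite (_ : u * u = fun y => u y ^+ 2).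
apply: is_derive_eq; first exact: is_derive_powR.
rewrite powR_norm_sqr powRB; last by rewrite (gt_eqF u2) implybT.
rewrite powRr1 ?ltW//; field.
by [].
Qed.

End PowerFunctions.

(** * The weighted integral of polynomials *)

Section WeightIntegrals.
Variables (R : realType) (alpha beta k : R).
Hypotheses (alpha_gtN1 : -1 < alpha) (k2_lt1 : 0 < k ^+ 2 < 1).
Notation mu := (@lebesgue_measure R).
Notation w := (weight alpha beta k).
Notation I := (`[(-1 : R), 1]%classic).
Implicit Types (p : {poly R}) (x : R).

Let u x : R := 1 - x ^+ 2.
Let v x : R := 1 - k ^+ 2 * x ^+ 2.

Lemma u_gt0 x : -1 < x < 1 -> 0 < u x.
Proof. by move=> /andP[x0 x1]; rewrite /u; nra. Qed.

Lemma v_bounds x : -1 <= x <= 1 -> 1 - k ^+ 2 <= v x <= 1.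
Proof.
move=> /andP[x0 x1]; have /andP[k0 k1] := k2_lt1.
have xx0 : 0 <= x ^+ 2 by exact: sqr_ge0.
have xx1 : x ^+ 2 <= 1 by nra.
by rewrite /v; apply/andP; split; nra.
Qed.

Lemma v_gt0 x : -1 <= x <= 1 -> 0 < v x.
Proof.
move=> /v_bounds/andP[+ _]; apply: lt_le_trans.
by rewrite subr_gt0; have /andP[] := k2_lt1.
Qed.

(* Integrable near the endpoints because alpha > -1. *)
Let g x : R := (1 - x) `^ alpha + (1 + x) `^ alpha.

(** For x >= 0 only the factor (1 - x)^alpha can be large; for x < 0, only
    (1 + x)^alpha. *)
Lemma weight_le_envelope x : -1 <= x <= 1 ->
  `|w x| <= (1 `^ alpha + 2 `^ alpha)
            * ((1 - k ^+ 2) `^ beta + 1 `^ beta) * g x.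
Proof.
move=> x11; have /andP[x0 x1] := x11.
have -> : w x = (1 - x) `^ alpha * (1 + x) `^ alpha * v x `^ beta.
  by rewrite /weight -powRM; [congr (_ `^ _ * _); ring|lra|lra].
have C0 r y : 0 <= y `^ r :> R := powR_ge0 _ _.
have vb : v x `^ beta <= (1 - k ^+ 2) `^ beta + 1 `^ beta.
  by apply: powR_le_endpoints; [rewrite subr_gt0; case/andP: k2_lt1|exact: v_bounds].
rewrite ger0_norm ?mulr_ge0// [leRHS]mulrAC; apply: ler_pM => //.
  by rewrite mulr_ge0.
have [x_ge0|x_lt0] := leP 0 x.
  rewrite [leRHS]mulrC; apply: ler_pM => //; first by rewrite lerDl.
  by apply: powR_le_endpoints; lra.
rewrite [leLHS]mulrC [leRHS]mulrC; apply: ler_pM => //; first by rewrite lerDr.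
by apply: powR_le_endpoints; lra.
Qed.

Lemma is_derive_linear_powR (s r x : R) : 0 < 1 + s * x ->
  is_derive x 1 (fun y => (1 + s * y) `^ r) (r * (1 + s * x) `^ (r - 1) * s).
Proof.
move=> sx0; have dl : is_derive x 1 (fun y => 1 + s * y) s.
  by apply: is_derive_eq; rewrite /GRing.scale/=; ring.
exact: is_derive_powR.
Qed.

Lemma envelope_integrable : mu.-integrable I (EFin \o g).
Proof.
have al0 : 0 < alpha + 1 by rewrite -ltrBlDr sub0r.
have gE x : g x = (1 + -1 * x) `^ alpha + (1 + 1 * x) `^ alpha.
  by rewrite /g mulN1r mul1r.
pose G x := (alpha + 1)^-1 *
  ((1 + 1 * x) `^ (alpha + 1) - (1 + -1 * x) `^ (alpha + 1)).
have pos x : x \in `](-1 : R), 1[ -> 0 < 1 + 1 * x /\ 0 < 1 + -1 * x.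
  by rewrite in_itv/= => /andP[x0 x1]; split; lra.
have dG x : x \in `](-1 : R), 1[ -> is_derive x 1 G (g x).
  move=> /pos[p1 p2].
  have d1 := is_derive_linear_powR (alpha + 1) p1.
  have d2 := is_derive_linear_powR (alpha + 1) p2.
  apply: is_derive_eq; rewrite gE !addrK /GRing.scale/=; field.
  by rewrite gt_eqF.
have cg : {in `](-1 : R), 1[, continuous g}.
  move=> x /pos[p1 p2]; apply/differentiable_continuous/derivable1_diffP.
  have d1 := is_derive_linear_powR alpha p1.
  have d2 := is_derive_linear_powR alpha p2.
  by rewrite (funext gE); exact: ex_derive.
have g0 x : 0 <= g x by rewrite addr_ge0 ?powR_ge0.
have oo : mu.-integrable `](-1 : R), 1[ (EFin \o g).
  apply: (@integrable_bounded_primitive _ _ G _ _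
           ((alpha + 1)^-1 * (2 `^ (alpha + 1) + 2 `^ (alpha + 1)))) => //.
  move=> x /pos[p1 p2]; rewrite normrM.
  rewrite (@ger0_norm _ (alpha + 1)^-1) ?invr_ge0 ?(ltW al0)//.
  apply: ler_wpM2l; first by rewrite invr_ge0 ltW.
  rewrite (le_trans (ler_normB _ _))// !ger0_norm ?powR_ge0//.
  by apply: lerD; apply: ge0_ler_powR; rewrite ?nnegrE; lra.
have mg : measurable_fun `](-1 : R), 1[ g.
  by apply: open_continuous_measurable_fun => // x; rewrite inE; exact: cg.
move/integrableP : oo => [_ goo]; apply/integrableP; split.
  apply/measurable_EFinP; rewrite /g; apply: measurable_funD.
    apply: (measurableT_comp (measurable_powR _)).
    exact: measurable_funB.
  apply: (measurableT_comp (measurable_powR _)).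
  exact: measurable_funD.
rewrite integral_itv_bndoo//; apply/measurable_EFinP.
by apply: measurableT_comp => //; exact/measurable_EFinP.
Qed.

Lemma horner_bound p x : -1 <= x <= 1 ->
  `|p.[x]| <= \sum_(i < size p) `|p`_i|.
Proof.
move=> x11; rewrite horner_coef; apply: (le_trans (ler_norm_sum _ _ _)).
apply: ler_sum => i _; rewrite normrM normrX ler_piMr//.
by rewrite exprn_ile1// ler_norml.
Qed.

Lemma measurable_weight (D : set R) : measurable_fun D w.
Proof.
apply: measurable_funTS; apply: measurable_funM.
  apply: (measurableT_comp (measurable_powR _)).
  by apply: measurable_funB => //; exact: measurable_funX.
apply: (measurableT_comp (measurable_powR _)).
by apply: measurable_funB => //; apply: measurable_funM => //; exact: measurable_funX.
Qed.

Lemma measurable_poly_weight p (D : set R) :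
  measurable_fun D (fun x => p.[x] * w x).
Proof.
apply: measurable_funM; last exact: measurable_weight.
apply: measurable_funTS; apply: continuous_measurable_fun => x.
exact: (@continuous_horner _ p x).
Qed.

Lemma poly_weight_integrable p :
  mu.-integrable I (EFin \o (fun x => p.[x] * w x)).
Proof.
have mI : measurable I by exact: measurable_itv.
pose C := (\sum_(i < size p) `|p`_i|) *
  ((1 `^ alpha + 2 `^ alpha) * ((1 - k ^+ 2) `^ beta + 1 `^ beta)).
have iC : mu.-integrable I (fun x => (C%:E * (EFin \o g) x)%E).
  exact: integrableZl envelope_integrable.
apply: le_integrable iC => //.
  by apply/measurable_EFinP; exact: measurable_poly_weight.
move=> x /=; rewrite in_itv/= => x11; rewrite lee_fin.
rewrite [leRHS]ger0_norm; last first.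
  rewrite mulr_ge0//; last by rewrite addr_ge0 ?powR_ge0.
  by rewrite mulr_ge0 ?sumr_ge0// mulr_ge0 ?addr_ge0 ?powR_ge0.
rewrite normrM -mulrA; apply: ler_pM => //; first exact: horner_bound.
exact: weight_le_envelope.
Qed.

Definition weighted_integral p : R := \int[mu]_(x in I) (p.[x] * w x).

Lemma weighted_integral_linear : linear (weighted_integral : _ -> R^o).
Proof.
move=> c p q; rewrite /weighted_integral /GRing.scale/=.
have mI : measurable I by exact: measurable_itv.
rewrite -RintegralZl//; last exact: poly_weight_integrable.
have icp : mu.-integrable I (EFin \o (fun x => c * (p.[x] * w x))).
  rewrite (_ : (fun x => _) = fun x => (c *: p).[x] * w x).
    exact: poly_weight_integrable.
  by apply/funext => x; rewrite hornerZ mulrA.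
rewrite -RintegralD//; last exact: poly_weight_integrable.
by apply: eq_Rintegral => x _; rewrite hornerD hornerZ; ring.
Qed.

(* The product p Y w with one factor 1 - x^2 absorbed into the power, which makes it
   vanish at the endpoints also when alpha < 0. *)
Let F p x : R := p.[x] * (v x * v x `^ beta * u x `^ (alpha + 1)).

Lemma is_derive_u x : is_derive x 1 u (- (2 * x)).
Proof.
have dx := is_derive_id x (1 : R).
by apply: is_derive_eq; rewrite /GRing.scale/=; ring.
Qed.

Lemma is_derive_v x : is_derive x 1 v (- (2 * k ^+ 2 * x)).
Proof. by apply: is_derive_eq; rewrite /GRing.scale/=; ring. Qed.

(** Inside the interval the differentiated function is p Y w. *)
Lemma is_derive_poly_Yw p x : -1 < x < 1 ->
  is_derive x 1 (F p)
    ((p^`() * poly_Y k + p * poly_T alpha beta k).[x] * w x).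
Proof.
move=> x11; have u0 := u_gt0 x11.
have x11' : -1 <= x <= 1 by case/andP: x11 => ? ?; rewrite !ltW.
have v0 := v_gt0 x11'.
have du := is_derive_powR (alpha + 1) u0 (is_derive_u x).
have dv := is_derive_powR beta v0 (is_derive_v x).
have dv1 := is_derive_v x.
have dp := is_derive_poly p x.
apply: is_derive_eq.
rewrite addrK -mulr_powR ?ltW// powRB ?(gt_eqF v0) ?implybT// powRr1 ?ltW//.
rewrite /weight -/(u x) -/(v x) /poly_Y /poly_T !hornerE /GRing.scale/=.
move: (u x `^ alpha) (v x `^ beta) => A B; rewrite /u /v; field.
by rewrite exprMn -/(v x) (gt_eqF v0).
Qed.

(** At the endpoints the power (1 - x^2)^(alpha + 1) tends to 0 because alpha > -1;
    the other factors are differentiable there. *)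
Lemma within_continuous_poly_Yw p : {within I, continuous (F p)}.
Proof.
have al0 : 0 < alpha + 1 by rewrite -ltrBlDr sub0r.
have cont_at x : x ^+ 2 = 1 -> forall T : set_system R, Filter T ->
    T --> x -> (\forall y \near T, 0 < u y) -> F p y @[y --> T] --> F p x.
  move=> x2 T FT Tx up; have v0 : 0 < v x.
    by rewrite /v x2 mulr1 subr_gt0; case/andP: k2_lt1.
  have ux : u x = 0 by rewrite /u x2 subrr.
  have cdiff (f : R -> R) (df : R) : is_derive x 1 f df -> f y @[y --> T] --> f x.
    move=> ?; apply: cvg_trans (cvg_app f Tx) _.
    by apply/differentiable_continuous/derivable1_diffP; exact: ex_derive.
  have c1 : p.[y] @[y --> T] --> p.[x] := cdiff (horner p) _ (is_derive_poly p x).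
  have c2 := cdiff v _ (is_derive_v x).
  have c3 := cdiff _ _ (is_derive_powR beta v0 (is_derive_v x)).
  have c4 : u y `^ (alpha + 1) @[y --> T] --> u x `^ (alpha + 1).
    rewrite ux powR0 ?gt_eqF//; apply: cvg_powR0 => //.
    by rewrite -ux; exact: cdiff u _ (is_derive_u x).
  exact: cvgM c1 (cvgM (cvgM c2 c3) c4).
apply/continuous_within_itvP; first by lra.
split.
- move=> x; rewrite in_itv/= => x11.
  apply/differentiable_continuous/derivable1_diffP.
  by have dF := is_derive_poly_Yw p x11; exact: ex_derive.
- apply: cont_at; [by ring|exact: cvg_at_right_filter|].
  near=> y; apply: u_gt0; apply/andP; split; near: y.
    exact: nbhs_right_gt.
  by apply: nbhs_right_lt; lra.
- apply: cont_at; [by ring|exact: cvg_at_left_filter|].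
  near=> y; apply: u_gt0; apply/andP; split; near: y.
    by apply: nbhs_left_gt; lra.
  exact: nbhs_left_lt.
Unshelve. all: by end_near. Qed.

(** Integration of (p Y w)', where p Y w vanishes at -1 and 1. *)
Lemma weighted_integral_pearson p :
  weighted_integral (p^`() * poly_Y k + p * poly_T alpha beta k) = 0.
Proof.
have al0 : alpha + 1 != 0 by rewrite gt_eqF// -ltrBlDr sub0r.
pose f x := (p^`() * poly_Y k + p * poly_T alpha beta k).[x] * w x.
have cf : {in `](-1 : R), 1[, continuous f}.
  move=> x; rewrite in_itv/= => x11.
  have u0 := u_gt0 x11.
  have v0 : 0 < v x by apply: v_gt0; case/andP: x11 => ? ?; rewrite !ltW.
  have du := is_derive_powR alpha u0 (is_derive_u x).
  have dv := is_derive_powR beta v0 (is_derive_v x).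
  have dw := is_deriveM du dv.
  apply: cvgM; first exact: continuous_horner.
  by apply/differentiable_continuous/derivable1_diffP;
    exact: (@ex_derive _ _ _ _ _ _ _ dw).
have dF x : x \in `](-1 : R), 1[ -> is_derive x 1 (F p) (f x).
  by rewrite in_itv/=; exact: is_derive_poly_Yw.
have lt11 : -1 < 1 :> R by lra.
transitivity (F p 1 - F p (-1)).
  have intf : mu.-integrable I (EFin \o f) by exact: poly_weight_integrable.
  rewrite -(integrable_FTC2 lt11 intf cf dF (@within_continuous_poly_Yw p)).
  by [].
have u1 x : x ^+ 2 = 1 -> u x = 0 by move=> x2; rewrite /u x2 subrr.
by rewrite /F (u1 1) ?(u1 (-1)) ?powR0 ?mulr0 ?subrr//; ring.
Qed.

Lemma finite_roots p : p != 0 -> finite_set [set x | p.[x] = 0].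
Proof.
move=> p0; apply: contrapT => /(infinite_set_fset (size p))[B Broots].
rewrite leqNgt => /negP; apply; apply: max_poly_roots => //.
  by apply/allP => x xB; apply/eqP/Broots.
exact: finmap.fset_uniq.
Qed.

(** The integrand is nonnegative and vanishes only at finitely many points of the
    interval, so it is not almost everywhere zero. *)
Lemma weighted_integral_sqr_neq0 p : p != 0 -> weighted_integral (p * p) != 0.
Proof.
move=> p0; apply/eqP => int0.
have mI : measurable I by exact: measurable_itv.
have iw := poly_weight_integrable (p * p).
pose f := EFin \o (fun x => (p * p).[x] * w x).
have w0 x : 0 <= w x by rewrite mulr_ge0 ?powR_ge0.
have : (\int[mu]_(x in I) `|f x|)%E = 0%E.
  transitivity (\int[mu]_(x in I) f x)%E.
    apply: eq_integral => x _; rewrite gee0_abs// lee_fin mulr_ge0//.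
    by rewrite hornerM -expr2 sqr_ge0.
  have fin : (\int[mu]_(x in I) f x)%E \is a fin_num.
    by apply: integrable_fin_num iw; exact: mI.
  by rewrite -(fineK fin); congr (_%:E); exact: int0.
move=> abs0; have ae0 : ae_eq mu I f (cst 0%E).
  by apply/ae_eq_integral_abs => //; exact: measurable_int iw.
have neg : mu.-negligible I.
  have fz : finite_set ([set x | p.[x] = 0] `|` [set 1; -1]).
    by rewrite finite_setU; split; [exact: finite_roots|exact: finite_set2].
  have mz := countable_lebesgue_measure0 (finite_set_countable fz).
  have nz : mu.-negligible ([set x | p.[x] = 0] `|` [set 1; -1]).
    by apply/negligibleP; [exact: countable_measurable (finite_set_countable fz)|].
  apply: negligibleS (negligibleU ae0 nz) => x Ix.
  have [rx|rx] := pselect (([set x | p.[x] = 0] `|` [set 1; -1]) x); first by right.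
  left => /= /(_ Ix) [] /eqP; apply/negP.
  move: Ix; rewrite /= in_itv/= => /andP[x0 x1].
  have xN1 : x != -1 by apply/eqP => xe; apply: rx; right; right.
  have xn1 : x != 1 by apply/eqP => xe; apply: rx; right; left.
  have px : p.[x] != 0 by apply/eqP => xe; apply: rx; left.
  have x11 : -1 < x < 1 by rewrite !lt_neqAle x0 x1 xn1 eq_sym xN1.
  have x11' : -1 <= x <= 1 by rewrite x0.
  have wx : w x != 0.
    by rewrite gt_eqF// mulr_gt0// powR_gt0//; [exact: u_gt0|exact: v_gt0].
  by rewrite hornerM; apply: mulf_neq0 => //; exact: mulf_neq0.
have : mu I = 0%E by apply/negligibleP.
rewrite lebesgue_measure_itv/= lte_fin.
have -> : (-1 < 1 :> R) by lra.
by move=> [] /eqP; rewrite opprK gt_eqF//; lra.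
Qed.

End WeightIntegrals.

(** * The differential equation *)

Lemma odeX_log_derivative (R : realType) (alpha beta k x : R) :
  odeX alpha beta k x != 0 -> odeY k x != 0 ->
  1 / 2 * (derive1 (odeX alpha beta k) x / odeX alpha beta k x) =
  (poly_T alpha beta k).[x] / odeY k x.
Proof.
move=> hX; rewrite /odeY mulf_eq0 negb_or => /andP[u0 v0].
have du := @is_derive_powR_norm R (fun y => 1 - y ^+ 2) _ (2 * alpha + 2) x u0
  (is_derive_u x).
have dv := @is_derive_powR_norm R (fun y => 1 - k ^+ 2 * y ^+ 2) _
  (2 * beta + 2) x v0 (is_derive_v k x).
have dX : is_derive x 1 (odeX alpha beta k)
    (((2 * alpha + 2) * - (2 * x) / (1 - x ^+ 2)
      + (2 * beta + 2) * - (2 * k ^+ 2 * x) / (1 - k ^+ 2 * x ^+ 2))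
     * odeX alpha beta k x).
  by apply: (is_derive_eq (is_deriveM du dv)); rewrite /odeX /GRing.scale/=; ring.
rewrite derive1E (@derive_val _ _ _ _ _ _ _ dX) mulfK// /poly_T.
rewrite !(hornerD, hornerM, hornerC, hornerX, hornerXn).
by field; rewrite ?exprMn u0 v0.
Qed.

Theorem theorem1p6 (R : realType) (alpha beta k : R)
    (P : nat -> {poly R}) (h b : nat -> R)
    (halpha : -1 < alpha) (hk : 0 < k ^+ 2 < 1)
    (hP : monic_orthogonal (weight alpha beta k) P h)
    (hb : recurrence_coeffs P b)
    (n : nat) (x : R)
    (hX : odeX alpha beta k x != 0)
    (hY : odeY k x != 0)
    (hM : odeM alpha beta k P b n x != 0) :
  let Pn : R -> R := fun y => (P n).[y] in
  let X : R -> R := odeX alpha beta k in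
  let Y : R -> R := odeY k in
  let M : R -> R := odeM alpha beta k P b n in
  let L : R -> R := odeL alpha beta k P b n in
  let U : R -> R := odeU alpha beta k P b n in
  derive1n 2 Pn x
  + (1 / 2 * (derive1 X x / X x) - derive1 M x / M x) * derive1 Pn x
  + (L x * derive1 M x / (Y x * M x) + U x / Y x) * Pn x = 0.
Proof.
move=> Pn X Y M L U.
have [P_monic P_orth] := hP.
pose w := weighted_integral alpha beta k.
have w_linear : linear (w : {poly R} -> R^o).
  exact: weighted_integral_linear.
have w_orth i j : w (P i * P j) = h j * (i == j)%:R.
  by rewrite -P_orth; apply: eq_Rintegral => y _; rewrite hornerM.
have h_neq0 i : h i != 0.
  have P_neq0 : P i != 0 by rewrite -size_poly_gt0 (P_monic i).2.
  have := weighted_integral_sqr_neq0 beta halpha hk P_neq0.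
  by have := w_orth i i; rewrite eqxx mulr1 => <-.
have w_pearson p : w (p^`() * poly_Y k + p * poly_T alpha beta k) = 0.
  exact: weighted_integral_pearson.
have PnE : derive1 Pn = horner (P n)^`() by rewrite derivE.
have Pn2E : derive1n 2 Pn x = ((P n)^`()^`()).[x].
  by rewrite /derive1n/= PnE -derivE.
have ME : M = horner (poly_M P b alpha beta k n).
  by apply/funext => y; rewrite /M /odeM /poly_M
     !(hornerD, hornerN, hornerM, hornerC, hornerXn, hornerX); ring.
have dM : derive1 M x = 2 * (- 2 * (alpha + beta + n%:R + 1 / 2) * k ^+ 2) * x.
  rewrite ME -derivE /poly_M derivB derivC subr0 derivM derivC derivXn.
  rewrite !(hornerD, hornerMn, hornerM, hornerC, hornerXn, hornerX).
  ring.
have LE : (poly_L P b alpha beta k n).[x] = L x.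
  by rewrite /L /odeL /poly_L
     !(hornerD, hornerN, hornerM, hornerC, hornerXn, hornerX); ring.
have UE : (poly_U P b alpha beta k n).[x] = U x.
  by rewrite /U /odeU /poly_U
     !(hornerD, hornerN, hornerM, hornerC, hornerXn, hornerX); ring.
have YE : (poly_Y k).[x] = Y x.
  by rewrite /Y /odeY /poly_Y
     !(hornerD, hornerN, hornerM, hornerC, hornerXn, hornerX); ring.
pose q : R := (b n *: prev_poly P n).[x].
have first_order : Y x * ((P n)^`()).[x] = L x * Pn x + M x * q.
  rewrite -YE -LE ME -!hornerM -hornerD.
  by rewrite (structure_relation w_linear P_monic w_orth h_neq0 hb w_pearson).
have second_order :
    Y x * ((P n)^`()^`()).[x] + (poly_T alpha beta k).[x] * ((P n)^`()).[x]
    + U x * Pn x = derive1 M x * q.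
  rewrite -YE -UE dM -!hornerM -!hornerD.
  rewrite (polynomial_ode w_linear P_monic w_orth h_neq0 hb w_pearson).
  by rewrite !(hornerM, hornerC, hornerX) -/q; ring.
have log_derivative := odeX_log_derivative hX hY.
rewrite log_derivative Pn2E PnE -/(Y x).
have Yx : Y x != 0 by [].
have Mx : M x != 0 by [].
have -> : ((P n)^`()^`()).[x] = (derive1 M x * q - U x * Pn x
    - (poly_T alpha beta k).[x] * ((P n)^`()).[x]) / Y x.
  by rewrite -second_order; field.
have -> : ((P n)^`()).[x] = (L x * Pn x + M x * q) / Y x.
  by rewrite -first_order; field.
by field; rewrite Yx Mx.
Qed.
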